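(* Let $u=u_1\cdots u_r$ be an allowed word of $\Sigma_A$ with $r\ge2$ whose weighted autocorrelation polynomial satisfies $\tau_u(z)=1+z^{r-1}\delta_u$. If $w=w_1\cdots w_r\in\mathcal L_r$ satisfies $w_1=u_1=u_r=w_r$ and $\delta_w=\delta_u$, then $\rho(C_w)\le\rho(C_u)$.
   Context: Let $\Sigma=\{1,\dots,N\}$, $A$ an irreducible $N\times N$ $0$–$1$ matrix, $\Sigma_A=\{x\in\Sigma^{\mathbb N}:A_{x_nx_{n+1}}=1\ \forall n\}$ with left shift $\sigma$; $\mathcal L_r$ is the set of allowed words of length $r$; $C_u$ is the set of $x\in\Sigma_A$ beginning with $u$. $P$ is a row-stochastic matrix with $P_{ij}>0$ iff $A_{ij}=1$, $\mathbf p$ its stationary vector, $\mu=\mu_P$ the Markov measure $\mu(C_v)=p_{v_1}P_{v_1v_2}\cdots P_{v_{n-1}v_n}$. For a hole $H$, $\mathcal W_m=\{x:\sigma^ix\notin H,0\le i\le m\}$ and $\rho(H)=-\lim_m\frac1m\ln\mu(\mathcal W_m)$. For $v=v_1\cdots v_r$: $\delta_v=P_{v_1v_2}\cdots P_{v_{r-1}v_r}$; for $0\le s\le r-1$, $c_{s,v,v}=1$ if $v_{s+1}\cdots v_r=v_1\cdots v_{r-s}$ and $0$ otherwise; $\delta_{s,v,v}=\prod_{j=r-s}^{r-1}P_{v_jv_{j+1}}$ (empty product $=1$); $\tau_v(z)=\sum_{s=0}^{r-1}c_{s,v,v}\delta_{s,v,v}z^s$. *)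

(* Defs.v *)
From HB Require Import structures.
From mathcomp Require Import all_boot all_order all_algebra.
From mathcomp Require Import all_classical all_reals all_analysis.
Set Implicit Arguments. Unset Strict Implicit. Unset Printing Implicit Defensive.
Import Order.TTheory GRing.Theory Num.Theory.
Local Open Scope ring_scope.

Section Markov.
Variables (R : realType) (N : nat).
Implicit Types (A : 'I_N -> 'I_N -> bool) (P : 'I_N -> 'I_N -> R) (p : 'I_N -> R)
  (v : seq 'I_N).

Definition allowed A v : bool := sorted (fun i j => A i j) v.

(* A irreducible: for all i j there is n >= 1 with (A^n)_{ij} > 0, i.e. an
   allowed path of positive length from i to j *)
Definition irreducible A : Prop :=
  forall i j : 'I_N, exists s : seq 'I_N, path (fun a b => A a b) i (rcons s j).

Definition transitions v : seq ('I_N * 'I_N) := zip v (behead v).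

Definition delta P v : R := \prod_(ab <- transitions v) P ab.1 ab.2.

Definition muC P p v : R :=
  if v is a :: _ then p a * delta P v else 1.

Definition cself v (s : nat) : bool := drop s v == take (size v - s) v.

Definition deltas P v (s : nat) : R :=
  \prod_(ab <- drop ((size v).-1 - s) (transitions v)) P ab.1 ab.2.

Definition tau P v : {poly R} :=
  \poly_(s < size v) ((cself v s)%:R * deltas P v s).

(* mu(W_m) for the hole H = C_w: W_m = {x : sigma^i x \notin C_w, 0 <= i <= m}.
   W_m is the disjoint finite union of the cylinders C_x, x allowed of length
   m + |w|, such that no shift drop i x (0 <= i <= m) begins with w. *)
Definition muW A P p (w : seq 'I_N) (m : nat) : R :=
  \sum_(x : (m + size w).-tuple 'I_N |
          allowed A x && [forall i : 'I_m.+1, ~~ prefix w (drop i x)])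
     muC P p x.

(* escape rate rho(C_w) = - lim_m (1/m) ln mu(W_m), in the extended reals
   (ln 0 = -oo, so rho = +oo when mu(W_m) = 0). *)
Definition rho A P p (w : seq 'I_N) : \bar R :=
  limn (fun m : nat => if muW A P p w m == 0 then +oo%E
                        else ((- ln (muW A P p w m)) / m%:R)%:E).

End Markov.

(* Main.v *)
Require Import Defs.
From HB Require Import structures.
From mathcomp Require Import all_boot all_order all_algebra ring lra.
From mathcomp Require Import all_classical all_reals all_analysis.
Import Order.TTheory GRing.Theory Num.Theory.
Local Open Scope ring_scope.
Set Implicit Arguments.
Unset Strict Implicit.
Unset Printing Implicit Defensive.

(** Let [f_w n] be the mass of the words of length [n] that avoid [w], and [h_w]
    the law of the end of the first occurrence of [w], so that
    [h_w 0 + ... + h_w n = 1 - f_w n].  Decomposing an occurrence of [w]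
    according to the first one gives the renewal equation [h_w * q_w = T], where
    [q_w d] is the weight of seeing [w] again [d] letters after an occurrence and
    [T n] is the mass of the words of length [n] ending in [w].  By stationarity
    [T n = mu(C_w)] for [n >= r] and [0] otherwise, so [T] is the same for [u] and
    [w].  As both words begin and end with [a], [q_w d] and [q_u d] agree for
    [d >= r - 1], and the hypothesis on [tau_u] says that [q_u d = 0] for
    [0 < d < r - 1]; hence [q_u <= q_w].  Convolving,
    [h_u * T - h_w * T = h_u * h_w * (q_w - q_u) >= 0], and since
    [(h * T) (n + r) = mu(C_u) (1 - f n)] this is [f_u n <= f_w n] for every [n].
    The limits defining the escape rates exist by Fekete's argument, because
    [f_w (m + n) <= C f_w m f_w n] with [C] depending only on [p]. *)

(** * Sums over the words of a fixed length *)

Section WordSum.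
Variables (R : realType) (N : nat).
Implicit Types (F G : seq 'I_N -> R) (x y z w : seq 'I_N).

(** Summing letter by letter over plain sequences lets words be cut and extended without casts
    between tuple lengths. *)
Fixpoint word_sum (n : nat) F : R :=
  if n is n'.+1 then \sum_c word_sum n' (fun x => F (c :: x)) else F [::].

Lemma eq_word_sum n F G :
  (forall x, size x = n -> F x = G x) -> word_sum n F = word_sum n G.
Proof.
elim: n F G => [|n IH] F G eqFG /=; first exact: eqFG.
by apply: eq_bigr => c _; apply: IH => x sx; apply: eqFG; rewrite /= sx.
Qed.

Lemma word_sum_ge0 n F : (forall x, size x = n -> 0 <= F x) -> 0 <= word_sum n F.
Proof.
elim: n F => [|n IH] F F0 /=; first exact: F0.
by apply: sumr_ge0 => c _; apply: IH => x sx; apply: F0; rewrite /= sx.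
Qed.

Lemma word_sum0 n : word_sum n (fun=> 0) = 0.
Proof. by elim: n => //= n IH; rewrite big1. Qed.

Lemma word_sumD n F G :
  word_sum n (fun x => F x + G x) = word_sum n F + word_sum n G.
Proof.
elim: n F G => //= n IH F G; rewrite -big_split /=.
by apply: eq_bigr => c _; rewrite IH.
Qed.

Lemma word_sumZ n (k : R) F : word_sum n (fun x => k * F x) = k * word_sum n F.
Proof.
by elim: n F => //= n IH F; rewrite mulr_sumr; apply: eq_bigr => c _; rewrite IH.
Qed.

Lemma word_sumN n F : word_sum n (fun x => - F x) = - word_sum n F.
Proof. by rewrite -mulN1r -word_sumZ; apply: eq_word_sum => x _; rewrite mulN1r. Qed.

Lemma ler_word_sum n F G :
  (forall x, size x = n -> F x <= G x) -> word_sum n F <= word_sum n G.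
Proof.
move=> leFG; rewrite -subr_ge0 -word_sumN -word_sumD.
by apply: word_sum_ge0 => x sx; rewrite subr_ge0 leFG.
Qed.

Lemma word_sum_sum n (I : Type) (r : seq I) (Fi : I -> seq 'I_N -> R) :
  word_sum n (fun x => \sum_(i <- r) Fi i x) = \sum_(i <- r) word_sum n (Fi i).
Proof.
elim: r => [|i r IH].
  by rewrite big_nil -[RHS](word_sum0 n); apply: eq_word_sum => x _; rewrite big_nil.
by rewrite big_cons -IH -word_sumD; apply: eq_word_sum => x _; rewrite big_cons.
Qed.

Lemma word_sum_cat m n F :
  word_sum (m + n) F = word_sum m (fun y => word_sum n (fun z => F (y ++ z))).
Proof. by elim: m F => //= m IH F; apply: eq_bigr => c _; rewrite IH. Qed.

Lemma word_sum_rcons n F :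
  word_sum n.+1 F = word_sum n (fun x => \sum_c F (rcons x c)).
Proof.
rewrite -addn1 word_sum_cat; apply: eq_word_sum => x _ /=.
by apply: eq_bigr => c _; rewrite cats1.
Qed.

Lemma word_sum_pred1 w F :
  word_sum (size w) (fun z => (w == z)%:R * F z) = F w.
Proof.
elim: w F => [|a w IH] F /=; first by rewrite mul1r.
rewrite (bigD1 a) //= big1 ?addr0.
  by rewrite -(IH (fun z => F (a :: z))); apply: eq_word_sum => z _; rewrite eqseq_cons eqxx.
move=> c ca; rewrite -[RHS](word_sum0 (size w)); apply: eq_word_sum => z _.
by rewrite eqseq_cons eq_sym (negPf ca) mul0r.
Qed.

Lemma word_sum_suffix m w F :
  word_sum (m + size w) (fun x => (suffix w x)%:R * F x) =
  word_sum m (fun y => F (y ++ w)).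
Proof.
rewrite word_sum_cat; apply: eq_word_sum => y _.
rewrite -(word_sum_pred1 w (fun z => F (y ++ z))); apply: eq_word_sum => z sz.
by rewrite -[w in suffix w _]cat0s suffix_catl // suffix0s andbT.
Qed.

Lemma word_sum_tuple n F : word_sum n F = \sum_(x : n.-tuple 'I_N) F x.
Proof.
elim: n F => [|n IH] F /=.
  rewrite (big_pred1 [tuple]) // => t; exact/esym/eqP/tuple0.
rewrite (eq_bigr _ (fun c _ => IH (fun x => F (c :: x)))) pair_bigA /=.
rewrite (reindex (fun t : n.+1.-tuple 'I_N => (thead t, [tuple of behead t]))) /=.
  by apply: eq_bigr => t _; rewrite [in RHS](tuple_eta t).
exists (fun ct : 'I_N * n.-tuple 'I_N => [tuple of ct.1 :: ct.2]).
  move=> t _; exact/esym/tuple_eta.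
by move=> [c t] _; congr (_, _); exact/val_inj.
Qed.

End WordSum.

(** * Comparison of two renewal equations with the same right-hand side *)

Section RenewalComparison.
Variable R : realType.

(* By [hu * (hw * qw) = hw * (hu * qu) + hu * hw * (qw - qu)] for the
   convolution product, computed here on truncations to polynomials. *)
Lemma renewal_comparison (hu hw qu qw T : nat -> R) :
  (forall n, 0 <= hu n) -> (forall n, 0 <= hw n) -> (forall n, qu n <= qw n) ->
  (forall n, \sum_(k < n.+1) hu k * qu (n - k)%N = T n) ->
  (forall n, \sum_(k < n.+1) hw k * qw (n - k)%N = T n) ->
  forall n, \sum_(k < n.+1) hw k * T (n - k)%N <= \sum_(k < n.+1) hu k * T (n - k)%N.
Proof.
move=> hu0 hw0 quw Tu Tw n.
pose tr (f : nat -> R) : {poly R} := \poly_(i < n.+1) f i.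
have trE (f : nat -> R) i : (i <= n)%N -> (tr f)`_i = f i by move=> le_in; rewrite coef_poly ltnS le_in.
have conv (f g : nat -> R) i : (i <= n)%N ->
    (tr f * tr g)`_i = \sum_(k < i.+1) f k * g (i - k)%N.
  move=> le_in; rewrite coefM; apply: eq_bigr => k _.
  by rewrite !trE ?(leq_trans (leq_subr _ _)) // (leq_trans _ le_in) // -ltnS.
have conv3 (f g h : nat -> R) : (forall i, \sum_(k < i.+1) g k * h (i - k)%N = T i) ->
    (tr f * (tr g * tr h))`_n = \sum_(k < n.+1) f k * T (n - k)%N.
  move=> gh; rewrite coefM; apply: eq_bigr => k _.
  by rewrite trE ?conv ?gh ?leq_subr // -ltnS.
rewrite -(conv3 hw hu qu Tu) -(conv3 hu hw qw Tw) -subr_ge0 -coefB.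
have -> : tr hu * (tr hw * tr qw) - tr hw * (tr hu * tr qu) =
    tr hu * (tr hw * (tr qw - tr qu)) by ring.
rewrite coefM; apply: sumr_ge0 => k _; apply: mulr_ge0.
  by rewrite trE // -ltnS.
rewrite coefM; apply: sumr_ge0 => j _.
have le_j : (j <= n)%N by rewrite (leq_trans _ (leq_subr k n)) // -ltnS.
apply: mulr_ge0; first by rewrite trE.
by rewrite coefB !trE ?subr_ge0 // (leq_trans (leq_subr _ _)) ?leq_subr.
Qed.

End RenewalComparison.

(** * Markov weights of words and shift invariance *)

Section MarkovMeasure.
Variables (R : realType) (N : nat).
Implicit Types (A : 'I_N -> 'I_N -> bool) (P : 'I_N -> 'I_N -> R) (p : 'I_N -> R).
Implicit Types (x y z w : seq 'I_N) (a b : 'I_N).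

Lemma delta1 P a : delta P [:: a] = 1.
Proof. by rewrite /delta /transitions big_nil. Qed.

Lemma delta_cons2 P a b x : delta P [:: a, b & x] = P a b * delta P (b :: x).
Proof. by rewrite /delta /transitions /= big_cons. Qed.

Lemma delta_cat P a x y : delta P (a :: x ++ y) = delta P (a :: x) * delta P (last a x :: y).
Proof.
elim: x a => [|b x IH] a /=; first by rewrite delta1 mul1r.
by rewrite !delta_cons2 IH mulrA.
Qed.

Lemma delta_ge0 P x : (forall i j, 0 <= P i j) -> 0 <= delta P x.
Proof. by move=> P0; apply: prodr_ge0. Qed.

Lemma delta_gt0 A P a x : (forall i j, 0 < P i j <-> A i j) ->
  path A a x -> 0 < delta P (a :: x).
Proof.
move=> PA; elim: x a => [|b x IH] a /=; first by rewrite delta1.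
by case/andP=> /PA Pab /IH; rewrite delta_cons2; exact: mulr_gt0.
Qed.

(** A forbidden word uses a transition of probability 0, so sums over allowed words extend to all
    words. *)
Lemma delta_not_allowed A P x : (forall i j, 0 <= P i j) ->
  (forall i j, 0 < P i j <-> A i j) -> ~~ allowed A x -> delta P x = 0.
Proof.
move=> P0 PA; case: x => // a x; rewrite /allowed /=.
elim: x a => //= b x IH a; rewrite negb_and => /orP[nA|/IH d0]; rewrite delta_cons2.
  suff -> : P a b = 0 by rewrite mul0r.
  apply/eqP; rewrite eq_le P0 andbT leNgt; apply/negP => /PA Aab.
  by rewrite Aab in nA.
by rewrite d0 mulr0.
Qed.

Lemma muC_cat P p a x y : muC P p (a :: x ++ y) = muC P p (a :: x) * delta P (last a x :: y).
Proof. by rewrite /= delta_cat mulrA. Qed.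

Lemma muC_ge0 P p x : (forall i j, 0 <= P i j) -> (forall i, 0 <= p i) -> 0 <= muC P p x.
Proof. by move=> P0 p0; case: x => //= a x; rewrite mulr_ge0 // delta_ge0. Qed.

Lemma sum_muC_rcons P p x : (forall i, \sum_j P i j = 1) -> \sum_i p i = 1 ->
  \sum_c muC P p (rcons x c) = muC P p x.
Proof.
move=> P1 p1; case: x => [|a x].
  by rewrite -[RHS]p1; apply: eq_bigr => c _; rewrite /= delta1 mulr1.
under eq_bigr => c _ do rewrite -cats1 cat_cons muC_cat delta_cons2 delta1 mulr1.
by rewrite -mulr_sumr P1 mulr1.
Qed.

Lemma sum_muC_cons P p x : \sum_i p i = 1 -> (forall j, \sum_i p i * P i j = p j) ->
  \sum_c muC P p (c :: x) = muC P p x.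
Proof.
move=> p1 pP; case: x => [|b x] /=.
  by rewrite -[RHS]p1; apply: eq_bigr => c _; rewrite delta1 mulr1.
by under eq_bigr do rewrite delta_cons2 mulrA; rewrite -mulr_suml pP.
Qed.

(** Shift invariance of the Markov measure: stationarity of [p] absorbs the letters of [y] one at a
    time. *)
Lemma word_sum_muC_cat P p m w : \sum_i p i = 1 -> (forall j, \sum_i p i * P i j = p j) ->
  word_sum m (fun y => muC P p (y ++ w)) = muC P p w.
Proof.
move=> p1 pP; elim: m => //= m IH; rewrite -[RHS]IH.
rewrite -(word_sum_sum m (index_enum _) (fun c y => muC P p (c :: y ++ w))).
by apply: eq_word_sum => y _; exact: sum_muC_cons.
Qed.

End MarkovMeasure.

(** * First occurrences and the renewal equation *)

Section FirstOccurrence.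
Variables (R : realType) (N : nat).
Variables (P : 'I_N -> 'I_N -> R) (p : 'I_N -> R).
Implicit Types (x y z w : seq 'I_N) (a b : 'I_N).

Definition first_occ w x : bool := suffix w x && ~~ infix w (take (size x).-1 x).

Definition avoid_mass w n : R := word_sum n (fun x => (~~ infix w x)%:R * muC P p x).

Definition hit_mass w n : R := word_sum n (fun x => (first_occ w x)%:R * muC P p x).

(* [a] stands for the last letter of [w]; for small [n] the two occurrences of
   [w] overlap, and this is then the coefficient of degree [n] of [tau P w]. *)
Definition return_mass w a n : R :=
  word_sum n (fun z => (suffix w (w ++ z))%:R * delta P (a :: z)).

Lemma first_occ_rcons w x c : first_occ w (rcons x c) = suffix w (rcons x c) && ~~ infix w x.
Proof. by rewrite /first_occ size_rcons -cats1 /= take_size_cat. Qed.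

(** Along the prefixes of [x], [infix w] turns from false to true at most once, exactly where
    [first_occ] holds. *)
Lemma sum_first_occ w x : w != [::] ->
  \sum_(k < (size x).+1) (first_occ w (take k x))%:R = (infix w x)%:R :> R.
Proof.
move=> w0; elim/last_ind: x => [|x c IH].
  by rewrite big_ord1 /= /first_occ suffixs0 infixs0 (negPf w0).
rewrite size_rcons big_ord_recr /= take_oversize ?size_rcons // first_occ_rcons.
rewrite (eq_bigr (fun k : 'I_(size x).+1 => (first_occ w (take k x))%:R)); last first.
  by move=> k _; rewrite -cats1 takel_cat // -ltnS.
rewrite IH infix_rconsl.
by case: (infix w x); case: (suffix w _); rewrite /= ?addr0 ?add0r.
Qed.

Hypothesis P0 : forall i j, 0 <= P i j.
Hypothesis P1 : forall i, \sum_j P i j = 1.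
Hypothesis p0 : forall i, 0 <= p i.
Hypothesis p1 : \sum_i p i = 1.
Hypothesis pP : forall j, \sum_i p i * P i j = p j.

Lemma avoid_mass_ge0 w n : 0 <= avoid_mass w n.
Proof. by apply: word_sum_ge0 => x _; rewrite mulr_ge0 ?ler0n ?muC_ge0. Qed.

Lemma hit_mass_ge0 w n : 0 <= hit_mass w n.
Proof. by apply: word_sum_ge0 => x _; rewrite mulr_ge0 ?ler0n ?muC_ge0. Qed.

Lemma return_mass_ge0 w a n : 0 <= return_mass w a n.
Proof. by apply: word_sum_ge0 => x _; rewrite mulr_ge0 ?ler0n ?delta_ge0. Qed.

Lemma avoid_mass0 w : w != [::] -> avoid_mass w 0 = 1.
Proof. by move=> w0; rewrite /avoid_mass /word_sum infixs0 w0 mul1r. Qed.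

Lemma avoid_massS w n : avoid_mass w n = avoid_mass w n.+1 + hit_mass w n.+1.
Proof.
rewrite /avoid_mass /hit_mass -word_sumD word_sum_rcons; apply: eq_word_sum => x _.
rewrite -(sum_muC_rcons x P1 p1) mulr_sumr; apply: eq_bigr => c _.
rewrite first_occ_rcons infix_rconsl -mulrDl; congr (_ * _).
by case: (infix w x); case: (suffix w _); rewrite /= ?addr0 ?add0r.
Qed.

Lemma sum_hit_mass w n : w != [::] -> \sum_(k < n.+1) hit_mass w k = 1 - avoid_mass w n.
Proof.
move=> w0; elim: n => [|n IH].
  by rewrite big_ord1 avoid_mass0 // subrr /hit_mass /= /first_occ suffixs0 (negPf w0) mul0r.
by rewrite big_ord_recr /= IH (avoid_massS w n); ring.
Qed.

Lemma suffix_mass w n : w != [::] ->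
  word_sum n (fun x => (suffix w x)%:R * muC P p x) = (size w <= n)%:R * muC P p w.
Proof.
move=> w0; case: leqP => [le_wn|lt_nw].
  by rewrite -(subnK le_wn) word_sum_suffix word_sum_muC_cat // mul1r.
rewrite mul0r -[RHS](word_sum0 R N n); apply: eq_word_sum => x sx.
case: (boolP (suffix w x)) => [/size_suffix|_]; last by rewrite mul0r.
by rewrite sx leqNgt lt_nw.
Qed.

Lemma suffix_cat_long w x y : (size w <= size y)%N -> suffix w (x ++ y) = suffix w y.
Proof.
move=> le_wy; rewrite !suffixE size_cat -addnBA // drop_cat.
by rewrite ltnNge leq_addr /= addKn.
Qed.

(** A word ending in [w] is cut at the end of its first occurrence of [w]; the Markov property
    splits its weight there, at the letter [a]. *)
Lemma renewal_equation w a n : w != [::] -> last a w = a ->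
  \sum_(k < n.+1) hit_mass w k * return_mass w a (n - k)%N =
  (size w <= n)%:R * muC P p w.
Proof.
move=> w0 wa; rewrite -suffix_mass //.
(* Exactly one cut [k] counts for a word with suffix [w], so the sum over [k] inserts a factor 1. *)
transitivity (word_sum n (fun x => \sum_(k < n.+1)
    (first_occ w (take k x))%:R * (suffix w x)%:R * muC P p x)); last first.
  apply: eq_word_sum => x sx; rewrite -!mulr_suml -sx sum_first_occ //.
  case: (boolP (suffix w x)) => [sux|_]; last by rewrite mulr0.
  by rewrite suffixW // mul1r.
rewrite word_sum_sum; apply: eq_bigr => k _.
have kn : (k <= n)%N by rewrite -ltnS.
move: (nat_of_ord k) kn => {}k kn; rewrite -[in RHS](subnKC kn) word_sum_cat /hit_mass mulrC -word_sumZ.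
apply: eq_word_sum => y sy.
rewrite (@eq_word_sum _ _ _ _ (fun z => ((first_occ w y)%:R * muC P p y) *
   ((suffix w (w ++ z))%:R * delta P (a :: z)))).
  by rewrite word_sumZ mulrC.
move=> z _; rewrite take_size_cat //.
case: (boolP (first_occ w y)) => [/andP[/suffixP[y' yE] _]|_]; last by rewrite !mul0r.
rewrite !mul1r mulrCA; congr (_ * _).
  by rewrite yE -catA suffix_cat_long // size_cat leq_addr.
have lasty : last a y = a by rewrite yE last_cat -[RHS]wa; case: (w) w0.
case: y sy yE lasty => [|b y] _ yE /= lasty.
  by move: w0; case: (w) yE; case: (y').
by rewrite -{1}lasty -[p b * delta P (b :: y)]/(muC P p (b :: y)) -muC_cat.
Qed.

End FirstOccurrence.

(** * Return masses of the two words *)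

Section Comparison.
Variables (R : realType) (N : nat) (A : 'I_N -> 'I_N -> bool).
Variables (P : 'I_N -> 'I_N -> R) (p : 'I_N -> R).
Implicit Types (u w x y z : seq 'I_N) (a b : 'I_N).

Lemma return_mass_0 w a : return_mass P w a 0 = 1.
Proof. by rewrite /return_mass /= cats0 suffix_refl delta1 mulr1. Qed.

(** At distance at least [size x], the new occurrence shares at most the letter [a] with the old
    one: a path goes from [a] to [a] in [m] steps, then reads [x]. Beyond its length, the word
    enters only through [a] and [delta]. *)
Lemma return_mass_long a x m : last a x = a ->
  return_mass P (a :: x) a (m + size x) =
  delta P (a :: x) * word_sum m (fun y => (last a y == a)%:R * delta P (a :: y)).
Proof.
move=> xa; rewrite /return_mass word_sum_cat -word_sumZ; apply: eq_word_sum => y sy.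
transitivity (word_sum (size x) (fun z =>
    (x == z)%:R * ((last a y == a)%:R * delta P (a :: y ++ z)))); last first.
  rewrite (word_sum_pred1 x (fun z => (last a y == a)%:R * delta P (a :: y ++ z))) delta_cat.
  by case: eqP => [->|_]; rewrite ?mul0r ?mulr0 // !mul1r mulrC.
apply: eq_word_sum => z sz; rewrite mulrA -natrM mulnb; congr (_%:R * _).
(* The possibly shared letter [a] joins [y ++ z]; the letters before it cannot meet the new
   occurrence. *)
have -> : (a :: x) ++ y ++ z = belast a x ++ a :: y ++ z.
  by rewrite [in LHS](lastI a x) xa cat_rcons.
rewrite suffix_cat_long; last first.
  by rewrite /= size_cat sz ltnS leq_addl.
rewrite -[a :: y ++ z]/((a :: y) ++ z) (lastI a y) cat_rcons -[a :: x]cat0s.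
by rewrite suffix_catl /= ?sz // suffix0s andbT eqseq_cons andbC [a == _]eq_sym.
Qed.

Lemma suffix_cat_cself u z : (size z <= size u)%N -> suffix u (u ++ z) -> cself u (size z).
Proof.
move=> szu; rewrite suffixE size_cat addKn drop_cat /cself => /eqP.
case: ltngtP szu => // [ltz _ E|szE _ _].
  by rewrite -{3}E take_size_cat // size_drop.
by rewrite szE drop_size subnn take0.
Qed.

(** The factors of [deltas] are among those of [delta P u], so no self-overlap is hidden by a
    vanishing coefficient of [tau]. *)
Lemma cself_tau_gt0 u s : (forall i j, 0 <= P i j) -> 0 < delta P u ->
  (s < size u)%N -> cself u s -> 0 < (tau P u)`_s.
Proof.
move=> P0 u0 su cus; rewrite coef_poly su cus mul1r lt_neqAle prodr_ge0 // andbT eq_sym.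
move: u0; rewrite lt_neqAle eq_sym => /andP[+ _].
rewrite /delta /deltas !prodf_seq_neq0 => /allP un0.
by apply/allP => ab /mem_drop; exact: un0.
Qed.

Lemma tau_edge_coef0 u s : tau P u = 1 + delta P u *: 'X^((size u).-1) ->
  (0 < s < (size u).-1)%N -> (tau P u)`_s = 0.
Proof.
move=> -> /andP[s0 su]; rewrite coefD coef1 coefZ coefXn.
by rewrite (gtn_eqF s0) (ltn_eqF su) mulr0 addr0.
Qed.

(** Equality holds for [n = 0] and for [n >= size x]; in between, a return of [a :: x] would be a
    self-overlap, which the shape of [tau] excludes. *)
Lemma return_mass_le a x y n : (forall i j, 0 <= P i j) ->
  0 < delta P (a :: x) -> size y = size x -> last a x = a -> last a y = a ->
  delta P (a :: y) = delta P (a :: x) ->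
  tau P (a :: x) = 1 + delta P (a :: x) *: 'X^((size (a :: x)).-1) ->
  return_mass P (a :: x) a n <= return_mass P (a :: y) a n.
Proof.
move=> P0 x0 syx xa ya dyx taux.
case: (leqP (size x) n) => [le_xn|lt_nx].
  rewrite -(subnK le_xn); move: (n - size x)%N => m.
  by rewrite return_mass_long // -syx return_mass_long // dyx.
case: n lt_nx => [|n] lt_nx; first by rewrite !return_mass_0.
suff -> : return_mass P (a :: x) a n.+1 = 0 by apply: return_mass_ge0.
rewrite /return_mass -[RHS](word_sum0 R N n.+1); apply: eq_word_sum => z sz.
case: (boolP (suffix _ _)) => [|_]; last by rewrite mul0r.
have lt_zx : (size z < size (a :: x))%N by rewrite sz /= ltnS ltnW.
move=> /(suffix_cat_cself (ltnW lt_zx)) /(cself_tau_gt0 P0 x0 lt_zx).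
by rewrite tau_edge_coef0 ?sz //= ltxx.
Qed.

(** * Comparison of the avoidance masses *)

Hypothesis P0 : forall i j, 0 <= P i j.
Hypothesis P1 : forall i, \sum_j P i j = 1.
Hypothesis p0 : forall i, 0 <= p i.
Hypothesis p1 : \sum_i p i = 1.
Hypothesis pP : forall j, \sum_i p i * P i j = p j.

(** At index [n + size w] the indicator keeps exactly the terms with [k <= n]. *)
Lemma hit_mass_conv w c n : w != [::] ->
  \sum_(k < (n + size w).+1) hit_mass P p w k * ((size w <= n + size w - k)%:R * c) =
  c * (1 - avoid_mass P p w n).
Proof.
move=> w0; rewrite -addSn big_split_ord /= [X in _ + X]big1 ?addr0 => [|k _]; last first.
  by rewrite addSnnS subnDl leqNgt ltn_subrL /= lt0n size_eq0 w0 mul0r mulr0.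
rewrite -(sum_hit_mass P1 p1) // mulr_sumr; apply: eq_bigr => k _.
by rewrite addnC -addnBA ?leq_addr ?mul1r 1?mulrC // -ltnS.
Qed.

Lemma avoid_mass_le a x y n :
  0 < p a -> 0 < delta P (a :: x) ->
  size y = size x -> last a x = a -> last a y = a ->
  delta P (a :: y) = delta P (a :: x) ->
  tau P (a :: x) = 1 + delta P (a :: x) *: 'X^((size (a :: x)).-1) ->
  avoid_mass P p (a :: x) n <= avoid_mass P p (a :: y) n.
Proof.
move=> pa x0 syx xa ya dyx taux.
have c0 : 0 < muC P p (a :: x) by rewrite mulr_gt0.
have muyx : muC P p (a :: y) = muC P p (a :: x) by rewrite /= dyx.
have eqx k : \sum_(i < k.+1) hit_mass P p (a :: x) i * return_mass P (a :: x) a (k - i)%N =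
    (size (a :: x) <= k)%:R * muC P p (a :: x) by exact: renewal_equation.
have eqy k : \sum_(i < k.+1) hit_mass P p (a :: y) i * return_mass P (a :: y) a (k - i)%N =
    (size (a :: x) <= k)%:R * muC P p (a :: x).
  by rewrite renewal_equation // muyx /= syx.
have retxy k := return_mass_le k P0 x0 syx xa ya dyx taux.
(* At this index both convolutions become one minus an avoidance mass, times the same positive
   constant. *)
have := renewal_comparison (hit_mass_ge0 P0 p0 _) (hit_mass_ge0 P0 p0 _) retxy eqx eqy
  (n + size (a :: x)).
have := @hit_mass_conv (a :: x) (muC P p (a :: x)) n isT.
have := @hit_mass_conv (a :: y) (muC P p (a :: x)) n isT.
rewrite /= syx => -> ->.
by rewrite ler_pM2l // lerD2l lerN2.
Qed.

(** * Monotonicity and submultiplicativity of the avoidance mass *)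

Lemma avoid_mass_nonincr w m n : (m <= n)%N -> avoid_mass P p w n <= avoid_mass P p w m.
Proof.
move=> /subnK <-; elim: (n - m)%N => // k IH; rewrite addSn.
by apply: le_trans IH; rewrite [leRHS](avoid_massS P1 p1) lerDl hit_mass_ge0.
Qed.

(** Some entry is positive because the total is 1; positivity spreads along transitions since
    [p b >= p i * P i b], and irreducibility reaches every letter. *)
Lemma stationary_gt0 : irreducible A -> (forall i j, 0 < P i j <-> A i j) ->
  forall i, 0 < p i.
Proof.
move=> irr PA j.
have [i pi] : exists i, 0 < p i.
  apply/existsP; apply: contraT; rewrite negb_exists => /forallP p_le0.
  suff : \sum_i p i = 0 by rewrite p1 => /eqP; rewrite oner_eq0.
  by apply: big1 => i _; apply/eqP; rewrite eq_le p0 andbT leNgt.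
have [s irrs] := irr i j; rewrite -(last_rcons i s j); move: irrs.
elim: (rcons s j) i pi => //= b t IH i pi /andP[/PA Pib]; apply: IH.
rewrite -pP (bigD1 i) //= ltr_pwDl ?mulr_gt0 //.
by apply: sumr_ge0 => k _; rewrite mulr_ge0.
Qed.

(** At the junction a transition probability, at most 1, is traded for [C * p b], at least 1, so
    that [y] starts afresh. *)
Lemma muC_cat_le (C : R) x y : 1 <= C -> (forall b, 1 <= C * p b) ->
  muC P p (x ++ y) <= C * muC P p x * muC P p y.
Proof.
move=> C1 Cp; have C0 : 0 <= C by rewrite (le_trans ler01).
case: x => [|a x]; first by rewrite mulr1 ler_peMl ?muC_ge0.
case: y => [|b y]; first by rewrite cats0 mulr1 ler_peMl ?muC_ge0.
rewrite cat_cons muC_cat delta_cons2 [C * _]mulrC -[leRHS]mulrA.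
apply: ler_wpM2l; first exact: muC_ge0.
rewrite /= mulrA; apply: ler_wpM2r; first exact: delta_ge0.
apply: le_trans (Cp b).
by rewrite -(P1 (last a x)) (bigD1 b) //= lerDl sumr_ge0.
Qed.

Lemma avoid_mass_submul (C : R) w m n : 1 <= C -> (forall b, 1 <= C * p b) ->
  avoid_mass P p w (m + n) <= C * avoid_mass P p w m * avoid_mass P p w n.
Proof.
move=> C1 Cp; rewrite /avoid_mass word_sum_cat mulrAC -word_sumZ.
apply: ler_word_sum => x _.
rewrite mulrAC -word_sumZ; apply: ler_word_sum => y _.
have C0 : 0 <= C by rewrite (le_trans ler01).
case: (boolP (infix w (x ++ y))) => [_|nxy].
  by rewrite mul0r !mulr_ge0 ?ler0n ?muC_ge0.
rewrite (contra (@infix_catr _ _ _ y) nxy) (contra (@infix_catl _ _ _ x) nxy) !mul1r.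
exact: muC_cat_le.
Qed.

Lemma stationary_const : (forall i, 0 < p i) ->
  exists2 C : R, 1 <= C & forall b, 1 <= C * p b.
Proof.
move=> p_gt0; pose C : R := \sum_b (p b)^-1.
have C0 : 0 <= C by apply: sumr_ge0 => b _; rewrite invr_ge0.
have Cp b : 1 <= C * p b.
  rewrite -(mulVf (lt0r_neq0 (p_gt0 b))) ler_wpM2r // /C (bigD1 b) //= lerDl.
  by apply: sumr_ge0 => i _; rewrite invr_ge0.
(* As [p] has total mass 1, [C] is the sum of the nonnegative [C * p i], one of which is already at
   least 1. *)
exists C => //; have -> : C = \sum_i C * p i by rewrite -mulr_sumr p1 mulr1.
have [b _] : exists b : 'I_N, true.
  case: (posnP N) => [N0|Npos]; last by exists (Ordinal Npos).
  move: p1; rewrite big1 => [/esym/eqP|i _]; first by rewrite oner_eq0.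
  by move: (ltn_ord i); rewrite {2}N0.
rewrite (bigD1 b) //= ler_wpDr //.
by apply: sumr_ge0 => i _; rewrite mulr_ge0.
Qed.

(** In a word of this length the possible starting positions of [w] are exactly 0 to [m]. *)
Lemma prefix_forall_infix w x m : size x = (m + size w)%N ->
  [forall i : 'I_m.+1, ~~ prefix w (drop i x)] = ~~ infix w x.
Proof.
move=> sx; apply/forallP/idP => [npre|ninf i]; last first.
  by apply: contra ninf => /prefixW/infix_trans; apply; exact: infix_drop.
apply/negP => /infixP[s [s' xE]].
have sm : (size s < m.+1)%N.
  by move: sx; rewrite xE !size_cat ltnS addnCA addnC => /addIn <-; rewrite leq_addr.
by have := npre (Ordinal sm); rewrite /= xE drop_size_cat // prefix_prefix.
Qed.

Lemma muW_avoid_mass w m : (forall i j, 0 < P i j <-> A i j) ->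
  muW A P p w m = avoid_mass P p w (m + size w).
Proof.
move=> PA; rewrite /muW /avoid_mass word_sum_tuple big_mkcond; apply: eq_bigr => x _.
rewrite prefix_forall_infix ?size_tuple //.
case: (boolP (allowed A x)) => /= [_|nA]; first by case: infix; rewrite ?mul0r ?mul1r.
suff -> : muC P p x = 0 by rewrite mulr0.
by case: (tval x) nA => // c t nA; rewrite /= (delta_not_allowed P0 PA nA) mulr0.
Qed.

End Comparison.

Import numFieldNormedType.Exports.
Local Open Scope classical_set_scope.

(** * Fekete's argument and existence of the rates *)

Section Fekete.
Variable R : realType.

(** With q the integer quotient of [m] by [n], q blocks of length [n] give at least [q * (b n - c)];
    monotonicity absorbs the remainder and the shift [r]. *)
Lemma superadditive_near_ge (b : nat -> R) (c : R) (r n : nat) (l : R) :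
  (forall m, 0 <= b m) -> {homo b : m k / (m <= k)%N >-> m <= k} ->
  (forall m k, b m + b k - c <= b (m + k)%N) ->
  (0 < n)%N -> l * n%:R < b n - c ->
  \forall m \near \oo, l <= b (m + r)%N / m%:R.
Proof.
move=> b0 bmono bsup n0 ltl.
have bmul q : q%:R * (b n - c) <= b (q * n)%N.
  elim: q => [|q IH]; first by rewrite mul0r.
  rewrite mulSn addnC (le_trans _ (bsup _ _)) // -addrA -natr1 mulrDl mul1r.
  by rewrite lerD2r.
have [l0|l0] := ltP l 0.
  by near=> m; rewrite (le_trans (ltW l0)) // divr_ge0.
have s0 : 0 < b n - c by rewrite (le_lt_trans _ ltl) // mulr_ge0.
(* Since q is at least [m / n - 1] as a real number, [q * (b n - c) >= l * m] follows once
   [m >= K]. *)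
pose K := n%:R * (b n - c) / (b n - c - l * n%:R).
near=> m.
have m0 : (0 < m)%N by near: m; exact: nbhs_infty_gt.
have Km : K <= m%:R by near: m; exact: nbhs_infty_ger.
rewrite ler_pdivlMr ?ltr0n // (le_trans _ (bmono m _ (leq_addr _ _))) //.
rewrite (le_trans _ (bmono (m %/ n * n)%N _ (leq_divM _ _))) // (le_trans _ (bmul _)) //.
have : m%:R <= (m %/ n)%:R * n%:R + n%:R :> R.
  rewrite -natrM -natrD ler_nat {1}(divn_eq m n) leq_add2l ltnW // ltn_mod //.
move: Km; rewrite ler_pdivrMr ?subr_gt0 // => Km mq.
have nR : 0 < n%:R :> R by rewrite ltr0n.
rewrite -(ler_pM2r nR).
have := ler_wpM2r (ltW s0) mq.
lra.
Unshelve. all: by end_near. Qed.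

(** The limit is the supremum of [(b n - c) / n] over positive [n], or infinity when these quotients
    are unbounded. *)
Lemma superadditive_cvg (b : nat -> R) (c : R) (r : nat) :
  (forall m, 0 <= b m) -> {homo b : m k / (m <= k)%N >-> m <= k} ->
  (forall m k, b m + b k - c <= b (m + k)%N) ->
  cvgn (fun m : nat => (b (m + r)%N / m%:R)%:E).
Proof.
move=> b0 bmono bsup.
pose E := [set x : R | exists2 n : nat, (0 < n)%N & x = (b n - c) / n%:R].
have nearE x l : E x -> l < x -> \forall m \near \oo, l <= b (m + r)%N / m%:R.
  move=> [n n0 ->]; rewrite ltr_pdivlMr ?ltr0n // => ltl.
  exact: (superadditive_near_ge r b0 bmono bsup n0 ltl).
have E0 : E !=set0 by exists ((b 1%N - c) / 1%:R), 1%N.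
have [Eub|nEub] := pselect (has_ubound E); last first.
  apply/cvg_ex; exists +oo%E; apply/cvgeyPge => l.
  have [x Ex ltx] : exists2 x, E x & l < x.
    apply: contrapT => nx; apply: nEub; exists l => x Ex.
    by rewrite leNgt; apply/negP => ltx; apply: nx; exists x.
  by apply: filterS (nearE x l Ex ltx) => m; rewrite lee_fin.
apply/cvg_ex; exists (sup E)%:E; apply: cvg_EFin; first exact: nearW.
apply/cvgrPdist_le => e e0; rewrite /comp /=.
have [x Ex ltx] := sup_adherent e0 (conj E0 Eub).
have := nearE x _ Ex ltx; apply: filter_app.
near=> m => lem.
rewrite ler_distlC lem /=.
have m0 : (0 < m)%N by near: m; exact: nbhs_infty_gt.
have mR : 0 < m%:R :> R by rewrite ltr0n.
rewrite ler_pdivrMr //.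
have : (b (m + r)%N - c) / (m + r)%:R <= sup E.
  by apply: ub_le_sup => //; exists (m + r)%N; rewrite ?addn_gt0 ?m0.
rewrite ler_pdivrMr ?ltr0n ?addn_gt0 ?m0 // natrD => lesup.
(* The shift [r] and the defect [c] cost at most [sup E * r + c], which is below [e * m] for large
   [m]. *)
have : (sup E * r%:R + c) / e <= m%:R by near: m; exact: nbhs_infty_ger.
rewrite ler_pdivrMr // => ?; lra.
Unshelve. all: by end_near. Qed.

(** The function [- ln f] is superadditive up to [ln C]; if [f] vanishes once, monotonicity makes
    the sequence eventually infinite. *)
Lemma submultiplicative_rate_cvg (f : nat -> R) (C : R) (r : nat) :
  (forall n, 0 <= f n) -> f 0%N = 1 -> {homo f : m n / (m <= n)%N >-> n <= m} ->
  0 < C -> (forall m n, f (m + n)%N <= C * f m * f n) ->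
  cvgn (fun m : nat => if f (m + r)%N == 0 then +oo%E
                       else (- ln (f (m + r)%N) / m%:R)%:E).
Proof.
move=> f0 f1 fmono C0 fsub.
have [[n fn0]|fn0] := pselect (exists n, f n = 0).
  apply/cvg_ex; exists +oo%E; apply: cvg_near_cst; near=> m.
  suff -> : f (m + r)%N == 0 by [].
  rewrite eq_le f0 andbT -fn0 fmono // (leq_trans _ (leq_addr _ _)) //.
  by near: m; exact: nbhs_infty_ge.
have fpos n : 0 < f n.
  by rewrite lt_neqAle f0 andbT eq_sym; apply/eqP => fn; apply: fn0; exists n.
rewrite (_ : (fun _ => _) = (fun m : nat => (- ln (f (m + r)%N) / m%:R)%:E)); last first.
  by apply/funext => m; rewrite gt_eqF.
apply: (@superadditive_cvg (fun n => - ln (f n)) (ln C)) => [n|m n mn|m n].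
- by rewrite oppr_ge0 ln_le0 // -f1 fmono.
- by rewrite lerN2 ler_ln ?posrE // fmono.
- rewrite -!opprD lerN2 addrC addrA -!lnM ?posrE ?mulr_gt0 // ler_ln ?posrE ?mulr_gt0 //.
Unshelve. all: by end_near. Qed.

End Fekete.

(** * From avoidance masses to escape rates *)

Theorem theorem5p2 (R : realType) (N : nat) (A : 'I_N -> 'I_N -> bool)
    (P : 'I_N -> 'I_N -> R) (p : 'I_N -> R) :
  irreducible A ->
  (forall i j, 0 <= P i j) ->
  (forall i j, 0 < P i j <-> A i j) ->
  (forall i, \sum_j P i j = 1) ->
  (forall i, 0 <= p i) -> \sum_i p i = 1 ->
  (forall j, \sum_i p i * P i j = p j) ->
  forall (u w : seq 'I_N) (a : 'I_N),
    (2 <= size u)%N -> allowed A u ->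
    tau P u = 1 + delta P u *: 'X^((size u).-1) ->
    size w = size u -> allowed A w ->
    ohead w = Some a -> ohead u = Some a -> last a u = a -> last a w = a ->
    delta P w = delta P u ->
    (rho A P p w <= rho A P p u)%E.
Proof.
move=> irr P0 PA P1 p0 p1 pP u w a _ uA tauu swu _ wa ua ula wla dwu.
have p_gt0 := stationary_gt0 P0 p0 p1 pP irr PA.
have [C C1 Cp] := stationary_const p0 p1 p_gt0.
have muWE v m : muW A P p v m = avoid_mass P p v (m + size v) by exact: muW_avoid_mass.
have rate_cvg v : v != [::] -> cvgn (fun m : nat =>
    if muW A P p v m == 0 then +oo%E else (- ln (muW A P p v m) / m%:R)%:E).
  move=> v0; under eq_fun do rewrite !muWE.
  apply: (@submultiplicative_rate_cvg R (avoid_mass P p v) C (size v)) => [n||m n mn||m n].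
  - exact: avoid_mass_ge0.
  - exact: avoid_mass0.
  - exact: avoid_mass_nonincr.
  - exact: lt_le_trans C1.
  - exact: avoid_mass_submul.
case: u uA tauu swu ua ula dwu => // b x uA tauu swu [ba]; subst b => xa.
case: w wa swu wla => // b y [ba] [syx]; subst b => ya dyx.
have x0 : 0 < delta P (a :: x) by exact: delta_gt0 PA uA.
apply: lee_lim; [exact: rate_cvg | exact: rate_cvg | apply: nearW => m].
have le_xy : muW A P p (a :: x) m <= muW A P p (a :: y) m.
  by rewrite !muWE /= syx avoid_mass_le.
(* Zero mass for [u] makes its term infinite; otherwise both masses are positive, and at [m = 0]
   both quotients are 0. *)
have [_|x_neq0] := eqVneq (muW A P p (a :: x) m) 0; first by rewrite leey.
have muWx : 0 < muW A P p (a :: x) m by rewrite lt_neqAle eq_sym x_neq0 muWE avoid_mass_ge0.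
have muWy := lt_le_trans muWx le_xy.
by rewrite gt_eqF // lee_fin ler_wpM2r // lerN2 ler_ln.
Qed.
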